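(* Let $(P,\lambda)$ be a marked poset which is strict and irredundant. The following are equivalent: (a) $\mathcal{C}(P,\lambda)$ is a 2-level polytope; (b) $\mathcal{C}(P,\lambda)$ is affinely isomorphic to a marked chain polytope $\mathcal{C}(P',\lambda')$ such that for every chain $a\prec p_1\prec\cdots\prec p_k\prec b$ (with $a,b\in P'^*$, $p_i\in P'\setminus P'^*$) whose inequality $x_{p_1}+\dots+x_{p_k}\le\lambda'(b)-\lambda'(a)$ defines a facet, one has $\lambda'(b)-\lambda'(a)=1$; (c) $\mathcal{C}(P,\lambda)$ is affinely isomorphic to the chain polytope of some finite poset.
   Context: A marked poset $(P,\lambda)$ is a finite poset $(P,\preceq)$ together with an induced subposet $P^*\subseteq P$ of marked elements and an order-preserving marking $\lambda:P^*\to\mathbb{R}$; it is always assumed that all minimal and all maximal elements of $P$ lie in $P^*$. It is strict if $\lambda(a)<\lambda(b)$ whenever $a\prec b$ in $P^*$, and irredundant (regular) if for every covering relation $p\prec q$ in $P$ and all $a,b\in P^*$ with $a\preceq q$ and $p\preceq b$, one has $a=b$ or $\lambda(a)<\lambda(b)$. The marked chain polytope $\mathcal{C}(P,\lambda)$ is the set of all $x\in\mathbb{R}_{\ge0}^{P\setminus P^*}$ with $x_{p_1}+\dots+x_{p_k}\le\lambda(b)-\lambda(a)$ for every maximal chain $a\prec p_1\prec\cdots\prec p_k\prec b$ in $P$ with $a,b\in P^*$ and $p_i\in P\setminus P^*$. The chain polytope of a finite poset $Q$ is $\{x\in\mathbb{R}^Q: x_c\ge0\ \forall c,\ x_{c_1}+\dots+x_{c_k}\le1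 \text{ for every chain } c_1\prec\cdots\prec c_k\}$. A polytope $Q\subseteq\mathbb{R}^d$ is 2-level if for every facet $F$ there is $t\in\mathbb{R}^d$ with every vertex of $Q$ in $\mathrm{aff}(F)$ or $t+\mathrm{aff}(F)$. Affinely isomorphic means related by $x\mapsto Mx+x_0$ with $M$ invertible. *)

(* Defs.v *)
From HB Require Import structures.
From mathcomp Require Import all_boot all_order all_algebra.
From mathcomp Require Import reals.
Set Implicit Arguments. Unset Strict Implicit. Unset Printing Implicit Defensive.
Import Order.TTheory GRing.Theory Num.Theory.
Local Open Scope ring_scope.

Section Polytopes.
Variable R : realType.

Definition pt (U : finType) := {ffun U -> R}.

Definition dotp (U : finType) (a x : pt U) : R := \sum_i a i * x i.

Definition is_vertex (U : finType) (Q : pt U -> Prop) (v : pt U) : Prop :=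
  Q v /\ forall (x y : pt U) (t : R), Q x -> Q y -> 0 < t < 1 ->
    v = [ffun i => t * x i + (1 - t) * y i] -> x = y.

Definition is_face (U : finType) (Q F : pt U -> Prop) : Prop :=
  exists (a : pt U) (beta : R),
    (forall x, Q x -> dotp a x <= beta) /\
    (forall x, F x <-> (Q x /\ dotp a x = beta)).

Definition affdim_ge (U : finType) (S : pt U -> Prop) (k : nat) : Prop :=
  exists v : 'I_k.+1 -> pt U, (forall i, S (v i)) /\
    forall c : 'I_k.+1 -> R, \sum_i c i = 0 ->
      (forall j, \sum_i c i * v i j = 0) -> forall i, c i = 0.

(** dim S = k (for k : nat; dim of the empty set is -1 and is never = k) *)
Definition affdim_eq (U : finType) (S : pt U -> Prop) (k : nat) : Prop :=
  affdim_ge S k /\ ~ affdim_ge S k.+1.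

Definition is_facet (U : finType) (Q F : pt U -> Prop) : Prop :=
  is_face Q F /\ exists k : nat, affdim_eq Q k.+1 /\ affdim_eq F k.

Definition aff_hull (U : finType) (S : pt U -> Prop) (x : pt U) : Prop :=
  exists (n : nat) (v : 'I_n -> pt U) (c : 'I_n -> R),
    (forall i, S (v i)) /\ \sum_i c i = 1 /\
    forall j, x j = \sum_i c i * v i j.

Definition two_level (U : finType) (Q : pt U -> Prop) : Prop :=
  forall F, is_facet Q F ->
    exists t : pt U, forall v, is_vertex Q v ->
      aff_hull F v \/ aff_hull F [ffun i => v i - t i].

(** affine maps x |-> A x + c, and affine isomorphism (A invertible,
    expressed as bijectivity of the affine map) *)
Definition affmap (U V : finType) (A : V -> U -> R) (c : V -> R) (x : pt U)
  : pt V := [ffun j => \sum_i A j i * x i + c j].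

Definition aff_isomorphic (U V : finType) (Q1 : pt U -> Prop) (Q2 : pt V -> Prop)
  : Prop :=
  exists (A : V -> U -> R) (c : V -> R),
    bijective (affmap A c) /\
    forall y, Q2 y <-> exists2 x, Q1 x & affmap A c x = y.

End Polytopes.

Section Posets.
Variable T : finType.
Variable le : rel T.

Definition is_poset : Prop :=
  reflexive le /\ antisymmetric le /\ transitive le.

Definition ltp (a b : T) : bool := le a b && (a != b).

Definition covers (p q : T) : bool :=
  ltp p q && ~~ [exists r, ltp p r && ltp r q].

Definition is_chain (C : {set T}) : Prop :=
  forall c d, c \in C -> d \in C -> le c d || le d c.

Variable R : realType.

(** marked poset: M = set of marked elements, lam the marking (only its
    values on M matter) *)
Definition marked_poset (M : {set T}) (lam : T -> R) : Prop :=
  [/\ is_poset,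
      (forall p, (forall q, le q p -> q = p) -> p \in M),
      (forall p, (forall q, le p q -> q = p) -> p \in M) &
      (forall a b, a \in M -> b \in M -> le a b -> lam a <= lam b)].

Definition strict_marking (M : {set T}) (lam : T -> R) : Prop :=
  forall a b, a \in M -> b \in M -> ltp a b -> lam a < lam b.

Definition irredundant (M : {set T}) (lam : T -> R) : Prop :=
  forall p q a b, covers p q -> a \in M -> b \in M -> le a q -> le p b ->
    a = b \/ lam a < lam b.

Definition marked_chain (M : {set T}) (a : T) (s : seq T) (b : T) : Prop :=
  [/\ a \in M, b \in M, all (fun p => p \notin M) s,
      path covers a s & covers (last a s) b].

Definition mcp (M : {set T}) (lam : T -> R)
  (x : pt R {p : T | p \notin M}) : Prop :=
  (forall u, 0 <= x u) /\
  forall a s b, marked_chain M a s b ->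
    \sum_(u | val u \in s) x u <= lam b - lam a.

Definition chain_polytope (x : pt R T) : Prop :=
  (forall c, 0 <= x c) /\
  forall C : {set T}, is_chain C -> \sum_(c in C) x c <= 1.

End Posets.

Arguments mcp [T] le [R] M lam x.
Arguments chain_polytope [T] le {R} x.

(* Main.v *)
Require Import Defs.
From HB Require Import structures.
From mathcomp Require Import all_boot all_order all_algebra.
From mathcomp Require Import reals.
From mathcomp Require Import boolp ring lra.
Import Order.TTheory GRing.Theory Num.Theory.
Local Open Scope ring_scope.

(** A full-dimensional polyhedron is cut out by its facet inequalities.  For an unmarked
    u let h u be the difference between the smallest label above u and the largest label
    below u; this is the maximum of the coordinate u on the marked chain polytope.  Each
    of (a) and (b) forces h u = lambda b - lambda a whenever the chain through u from a to
    b defines a facet: in case (a) because 0 and h u * e_u are vertices, in case (b)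
    because e_u satisfies all facet inequalities.  Hence along a facet chain the extreme
    labels above and below do not change.  Order the unmarked elements by "u <= v, with
    the same extreme labels above and below": facet chains are chains of this order, and
    conversely no marked element can separate two elements of such a chain, so it extends
    to a saturated marked chain with right-hand side h u.  Dividing the coordinate u by
    h u therefore yields a chain polytope.  Conversely, the vertices of a chain polytope
    are 0/1 vectors, so it is 2-level, and adjoining a bottom labelled 0 and a top
    labelled 1 turns it into a marked chain polytope. *)

Lemma eq_ler (R : numDomainType) (x y : R) : x = y -> x <= y.
Proof. by move->. Qed.

(** * Algebraic interior and affine dimension in coordinate space *)

Section FiniteSystems.
Context {R : realType} {U : finType}.
Implicit Types (x y z v a d : pt R U) (Q F S : pt R U -> Prop).

Definition ray z d (e : R) : pt R U := [ffun i => z i + e * d i].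

(** The algebraic interior, used in place of a topological one: the step [e] may depend on the
    direction [d], and [d = 0] gives membership of [z]. *)
Definition core Q z : Prop := forall d, exists2 e, 0 < e & Q (ray z d e).

Lemma dotp_ray a z d e : dotp a (ray z d e) = dotp a z + e * dotp a d.
Proof.
rewrite /dotp mulr_sumr -big_split; apply: eq_bigr => i _ /=.
by rewrite ffunE; ring.
Qed.

Lemma dotp_conv a x y (t : R) :
  dotp a [ffun i => t * x i + (1 - t) * y i] = t * dotp a x + (1 - t) * dotp a y.
Proof.
rewrite /dotp !mulr_sumr -big_split; apply: eq_bigr => i _ /=.
by rewrite ffunE; ring.
Qed.

Lemma dotp_indicator (P : pred U) x :
  dotp [ffun d => (P d)%:R] x = \sum_(d | P d) x d.
Proof.
rewrite /dotp [RHS]big_mkcond; apply: eq_bigr => d _; rewrite ffunE.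
by case: (P d); rewrite ?mul1r ?mul0r.
Qed.

Lemma dotp_opp_unit (c : U) x :
  dotp [ffun d => - (d == c)%:R] x = - x c.
Proof.
rewrite /dotp (bigD1 c) //= ffunE eqxx big1 => [|d /negPf dc].
  by rewrite addr0 mulN1r.
by rewrite ffunE dc oppr0 mul0r.
Qed.

Lemma dotp0l x : dotp [ffun=> 0] x = 0.
Proof. by rewrite /dotp big1 // => i _; rewrite ffunE mul0r. Qed.

Lemma ray0r z e : ray z [ffun=> 0] e = z.
Proof. by apply/ffunP => i; rewrite !ffunE mulr0 addr0. Qed.

Lemma core_mem Q z : core Q z -> Q z.
Proof. by case/(_ [ffun=> 0]) => e _; rewrite ray0r. Qed.

Lemma pt_neq0 a : a != [ffun=> 0] -> exists i, a i != 0.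
Proof.
move=> a0; apply/existsP; apply: contraT; rewrite negb_exists => /forallP a0'.
case/negP: a0; apply/eqP/ffunP => i; rewrite ffunE.
by have := a0' i; rewrite negbK => /eqP.
Qed.

Lemma dotp_gt0 a : a != [ffun=> 0] -> 0 < dotp a a.
Proof.
case/pt_neq0 => i ai0; rewrite /dotp (bigD1 i) //= ltr_pwDl //.
  by rewrite -expr2 exprn_even_gt0.
by apply: sumr_ge0 => j _; rewrite -expr2 sqr_ge0.
Qed.

(** A small step from [z] in the direction [a] itself stays in [Q] and increases the functional by
    [e * dotp a a > 0]. *)
Lemma core_strict {Q z a} {b : R} : core Q z -> (forall x, Q x -> dotp a x <= b) ->
  a != [ffun=> 0] -> dotp a z < b.
Proof.
move=> cz Qb a0; have [e e0 /Qb] := cz a; rewrite dotp_ray.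
by apply: lt_le_trans; rewrite ltrDl mulr_gt0 // dotp_gt0.
Qed.

Lemma fin_small_pos (I : finType) (P : I -> R -> Prop) :
  (forall i, exists2 e, 0 < e & forall e', 0 < e' <= e -> P i e') ->
  exists2 e, 0 < e & forall i, P i e.
Proof.
move=> h.
have /choice[e eP] : forall i, exists e, 0 < e /\ forall e', 0 < e' <= e -> P i e'.
  by move=> i; have [e e0 eP] := h i; exists e.
exists (\big[Num.min/1]_i e i).
  by apply: lt_bigmin => // i _; case: (eP i).
move=> i; apply: (eP i).2; rewrite bigmin_le_cond // andbT.
by apply: lt_bigmin => // j _; case: (eP j).
Qed.

Definition aff_indep (J : finType) (v : J -> pt R U) : Prop :=
  forall c : J -> R, \sum_i c i = 0 ->
    (forall j, \sum_i c i * v i j = 0) -> forall i, c i = 0.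

Lemma affdim_ge_family {S k} {J : finType} (v : J -> pt R U) :
  #|J| = k.+1 -> (forall i, S (v i)) -> aff_indep J v -> affdim_ge S k.
Proof.
move=> cJ Sv iv; pose g (i : 'I_k.+1) : J := enum_val (cast_ord (esym cJ) i).
pose g' (l : J) := cast_ord cJ (enum_rank l).
have gK : cancel g' g by move=> l; rewrite /g /g' cast_ordK enum_rankK.
have Kg : cancel g g' by move=> l; rewrite /g /g' enum_valK cast_ordKV.
have gbij : {on [pred _ | true], bijective g} by exists g' => l _.
exists (fun i => v (g i)); split=> // c c0 cv i.
rewrite -(Kg i); apply: (iv (fun l => c (g' l))) => [|j].
  by rewrite (reindex g) // -[RHS]c0; apply: eq_bigr => l _; rewrite Kg.
by rewrite (reindex g) // -[RHS](cv j); apply: eq_bigr => l _; rewrite Kg.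
Qed.

Lemma affdim_ge_pred S k : affdim_ge S k.+1 -> affdim_ge S k.
Proof.
case=> v [Sv iv]; exists (fun i => v (lift ord_max i)); split=> // c c0 cv i.
(* Coefficients for all points, with the dropped last point weighted 0. *)
pose c' j := if unlift ord_max j is Some l then c l else 0.
have -> : c i = c' (lift ord_max i) by rewrite /c' liftK.
have sumE (G : 'I_k.+2 -> R) : G ord_max = 0 ->
    \sum_l G l = \sum_l G (lift ord_max l).
  move=> G0; rewrite big_ord_recr /= G0 addr0; apply: eq_bigr => l _.
  by congr G; apply: val_inj; rewrite /= /bump leqNgt ltn_ord.
apply: iv => [|j]; rewrite sumE /c' ?unlift_none ?mul0r //.
  by rewrite -[RHS]c0; apply: eq_bigr => l _; rewrite liftK.
by rewrite -[RHS](cv j); apply: eq_bigr => l _; rewrite liftK.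
Qed.

Lemma affdim_ge_le S k m : (m <= k)%N -> affdim_ge S k -> affdim_ge S m.
Proof.
move=> /subnKC <-; elim: (k - m)%N => [|l IH]; first by rewrite addn0.
by rewrite addnS => /affdim_ge_pred.
Qed.

(* Affine independence of points is linear independence of the rows (1, v_i). *)
Definition homog_mx n (v : 'I_n -> pt R U) : 'M[R]_(n, 1 + #|U|) :=
  row_mx (const_mx 1) (\matrix_(i, j) v i (enum_val j)).

Lemma mul_homog_mxE n (v : 'I_n -> pt R U) (c : 'rV[R]_n) :
  c *m homog_mx n v = row_mx (const_mx (\sum_i c 0 i))
    (\row_j (\sum_i c 0 i * v i (enum_val j))).
Proof.
rewrite mul_mx_row; congr row_mx; apply/rowP => j; rewrite !mxE.
  by apply: eq_bigr => i _; rewrite mxE mulr1.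
by apply: eq_bigr => i _; rewrite mxE.
Qed.

Lemma aff_indep_row_free n (v : 'I_n -> pt R U) :
  aff_indep 'I_n v -> row_free (homog_mx n v).
Proof.
move=> iv; rewrite -kermx_eq0; apply/eqP/row_matrixP => i; rewrite row0.
set c := row i _; have: c *m homog_mx n v = 0.
  by rewrite -row_mul mulmx_ker row0.
rewrite mul_homog_mxE -[RHS]row_mx0 => /eq_row_mx[c0 cv].
apply/rowP => l; rewrite [RHS]mxE; apply: (iv (c 0)) => [|j].
  by have /rowP/(_ 0) := c0; rewrite [LHS]mxE [RHS]mxE.
have /rowP/(_ (enum_rank j)) := cv.
by rewrite [LHS]mxE [RHS]mxE enum_rankK.
Qed.

Lemma aff_indep_le n (v : 'I_n.+1 -> pt R U) :
  aff_indep 'I_n.+1 v -> (n <= #|U|)%N.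
Proof.
move/aff_indep_row_free; rewrite /row_free => /eqP rk.
by have := rank_leq_col (homog_mx n.+1 v); rewrite rk.
Qed.

(** The column [(-b, a)]: a homogenised row [(r, x)] lies in its kernel exactly when
    [dotp a x = r * b]. *)
Definition hyperplane_col a (b : R) : 'cV[R]_(1 + #|U|) :=
  col_mx (const_mx (- b)) (\col_j a (enum_val j)).

Lemma row_hyperplane_col x a b (r : R) :
  row_mx (const_mx r) (\row_j x (enum_val j)) *m hyperplane_col a b
  = const_mx (dotp a x - r * b).
Proof.
rewrite mul_row_col; apply/matrixP => i j; rewrite !mxE big_ord1 !mxE mulrN.
rewrite addrC; congr (_ - _); rewrite /dotp.
rewrite (big_enum_val (A := U) (fun i => a i * x i)).
by apply: eq_bigr => l _; rewrite !mxE mulrC.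
Qed.

Lemma rank_hyperplane a (b : R) : a != [ffun=> 0] ->
  \rank (kermx (hyperplane_col a b)) = #|U|.
Proof.
case/pt_neq0 => i ai0; rewrite mxrank_ker.
have h0 : hyperplane_col a b != 0.
  apply/eqP => /colP/(_ (rshift 1 (enum_rank i))).
  rewrite /hyperplane_col col_mxEd !mxE enum_rankK => /eqP.
  by rewrite (negPf ai0).
have -> : \rank (hyperplane_col a b) = 1%N.
  by apply/eqP; rewrite eqn_leq rank_leq_col lt0n mxrank_eq0.
by rewrite add1n subn1.
Qed.

Lemma homog_mx_hyperplane n (v : 'I_n -> pt R U) a (b : R) :
  (forall i, dotp a (v i) = b) -> (homog_mx n v <= kermx (hyperplane_col a b))%MS.
Proof.
move=> vb; apply/sub_kermxP/row_matrixP => i; rewrite row_mul row0.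
have -> : row i (homog_mx n v) = row_mx (const_mx 1) (\row_j v i (enum_val j)).
  by rewrite row_row_mx; congr row_mx; apply/rowP => j; rewrite !mxE.
rewrite row_hyperplane_col vb mul1r subrr.
by apply/matrixP => l m; rewrite !mxE.
Qed.

(** The rows [(1, v i)] lie in the kernel of [hyperplane_col a b] and have the same rank, so they
    span it. Writing [(1, x)] in terms of them, the first column says that the coefficients sum to
    1. *)
Lemma hyperplane_aff_hull {F k a} {b : R} : k.+1 = #|U| -> a != [ffun=> 0] ->
  forall v : 'I_k.+1 -> pt R U, (forall i, F (v i)) -> aff_indep 'I_k.+1 v ->
  (forall i, dotp a (v i) = b) -> forall x, dotp a x = b -> aff_hull F x.
Proof.
move=> cU a0 v Fv iv vb x xb.
have rA := eqP (aff_indep_row_free _ _ iv).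
have sA := homog_mx_hyperplane _ _ _ _ vb.
have eA : (kermx (hyperplane_col a b) <= homog_mx k.+1 v)%MS.
  by rewrite -(geq_leqif (mxrank_leqif_sup sA)) rank_hyperplane // rA cU.
have : (row_mx (const_mx 1) (\row_j x (enum_val j)) <= homog_mx k.+1 v)%MS.
  apply: submx_trans eA; apply/sub_kermxP.
  rewrite row_hyperplane_col xb mul1r subrr.
  by apply/matrixP => l m; rewrite !mxE.
case/submxP => c; rewrite mul_homog_mxE => /eq_row_mx[c1 cx].
exists k.+1, v, (c 0); split=> //; split.
  by have /rowP/(_ 0) := c1; rewrite !mxE.
by move=> j; have /rowP/(_ (enum_rank j)) := cx; rewrite !mxE enum_rankK.
Qed.

Lemma affdim_ge_hyperplane {S k a} {b : R} : a != [ffun=> 0] ->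
  (forall x, S x -> dotp a x = b) -> affdim_ge S k -> (k < #|U|)%N.
Proof.
move=> a0 Sb [v [Sv /aff_indep_row_free/eqP rA]].
have /mxrankS := homog_mx_hyperplane _ _ _ _ (fun i => Sb _ (Sv i)).
by rewrite rank_hyperplane // rA.
Qed.

Lemma affdim_ge_card {S k} : affdim_ge S k -> (k <= #|U|)%N.
Proof. by case=> v [_ /aff_indep_le]. Qed.

Lemma sum_option (G : option U -> R) : \sum_o G o = G None + \sum_j G (Some j).
Proof.
rewrite (bigD1 None) //=; congr (_ + _).
rewrite (reindex_omap Some id) /=; last by case.
by apply: eq_bigl => j; rewrite eqxx.
Qed.

(** The point [z] (index [None]) and one small step from it along each coordinate axis are
    [#|U| + 1] affinely independent points; more do not exist. *)
Lemma core_affdim {Q z} : core Q z -> affdim_eq Q #|U|.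
Proof.
move=> cz; split; last by move/affdim_ge_card; rewrite ltnn.
have /choice[e eP] : forall j, exists e, 0 < e /\ Q (ray z [ffun l => (l == j)%:R] e).
  by move=> j; have [e e0 Qe] := cz [ffun l => (l == j)%:R]; exists e.
pose v (o : option U) := if o is Some j then ray z [ffun l => (l == j)%:R] (e j) else z.
apply: (affdim_ge_family v); first by rewrite card_option.
  by case=> [j|] /=; [case: (eP j) | exact: core_mem].
move=> c; rewrite sum_option /= => c0 cv.
have cS j : c (Some j) = 0.
  have := cv j; rewrite sum_option /=.
  under eq_bigr => l _ do rewrite !ffunE mulrDr.
  rewrite big_split /= -mulr_suml addrA -mulrDl c0 mul0r add0r.
  rewrite (bigD1 j) //= big1 => [|l lj]; last first.
    by rewrite eq_sym (negPf lj) !mulr0.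
  rewrite eqxx mulr1 addr0 => /eqP; rewrite mulf_eq0 => /orP[/eqP//|/eqP ej].
  by have [] := eP j; rewrite ej ltxx.
case=> [j|]; first exact: cS.
by move: c0; rewrite big1 ?addr0.
Qed.

(** The hypothesis on [w] is interiority relative to the hyperplane. Small steps from [w] along a
    basis of the direction space, together with [w] itself, give [#|U|] affinely independent points;
    [w] is stored at the index [i0] that the basis omits. *)
Lemma relative_core_affdim {F w a} {b : R} {k} : k.+1 = #|U| ->
  a != [ffun=> 0] -> (forall x, F x -> dotp a x = b) ->
  (forall d, dotp a d = 0 -> exists2 e, 0 < e & F (ray w d e)) -> affdim_eq F k.
Proof.
move=> kU a0 Fb cw; split; last first.
  by move/(affdim_ge_hyperplane a0 Fb); rewrite -kU ltnn.
have [i0 ai0] := pt_neq0 _ a0.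
(* The direction [e_j - (a_j / a_i0) e_i0], which is orthogonal to [a]. *)
pose t j : pt R U := [ffun l => (l == j)%:R - a j / a i0 * (l == i0)%:R].
have at0 j : dotp a (t j) = 0.
  rewrite /dotp; under eq_bigr do rewrite ffunE mulrBr.
  rewrite sumrB (bigD1 j) //= eqxx mulr1 big1 => [|l /negPf->]; last by rewrite mulr0.
  rewrite (bigD1 i0) //= eqxx mulr1 big1 => [|l /negPf->]; last by rewrite !mulr0.
  by rewrite !addr0 mulrCA divff // mulr1 subrr.
have /choice[e eP] : forall j, exists e, 0 < e /\ F (ray w (t j) e).
  by move=> j; have [e e0 Fe] := cw _ (at0 j); exists e.
have Fw : F w.
  by have [|e' _] := cw [ffun=> 0]; rewrite ?ray0r // /dotp big1 // => i _; rewrite ffunE mulr0.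
pose v j := if j == i0 then w else ray w (t j) (e j).
apply: (affdim_ge_family v) => //.
  by move=> j; rewrite /v; case: ifP => // _; case: (eP j).
move=> c c0 cv.
have cj j : j != i0 -> c j = 0.
  move=> ji0; have := cv j.
  have vE l : c l * v l j = c l * w j + (l == j)%:R * (c j * e j).
    rewrite /v; case: (eqVneq l i0) => [->|li0].
      by rewrite eq_sym (negPf ji0) mul0r addr0.
    rewrite !ffunE (negPf ji0) (eq_sym j l).
    by case: eqP => [->|_]; rewrite ?mulr0 ?subr0 ?mulr1 ?mul1r ?mul0r ?mulr0 ?addr0 // mulrDr.
  under eq_bigr => l _ do rewrite vE.
  rewrite big_split /= -mulr_suml c0 mul0r add0r -mulr_suml.
  rewrite (bigD1 j) //= eqxx big1 => [|l /negPf->] //; rewrite addr0 mul1r => /eqP.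
  rewrite mulf_eq0 => /orP[/eqP//|/eqP ej].
  by have [] := eP j; rewrite ej ltxx.
move=> j; have [->|/cj//] := eqVneq j i0.
by move: c0; rewrite (bigD1 i0) //= big1 ?addr0.
Qed.

(** * Facets of a polyhedron and a criterion for being 2-level *)

Section System.
Context {I : finType} {n : I -> pt R U} {b : I -> R}.

Definition polyhedron x : Prop := forall i, dotp (n i) x <= b i.

(** A constraint with slack survives every short move, and one that does not increase along [d]
    survives any move; finitely many thresholds have a positive minimum. *)
Lemma small_step {J : {set I}} {w d} : (forall i, i \in J -> dotp (n i) w <= b i) ->
  (forall i, i \in J -> dotp (n i) w < b i \/ dotp (n i) d <= 0) ->
  exists2 e, 0 < e & forall i, i \in J -> dotp (n i) (ray w d e) <= b i.
Proof.
move=> wb sd; apply: fin_small_pos => i.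
have [iJ|_] := boolP (i \in J); last by exists 1.
case: (sd i iJ) => [lt|le0]; last first.
  exists 1 => // e /andP[e0 _] _; rewrite dotp_ray.
  by have := wb i iJ; have := mulr_ge0_le0 (ltW e0) le0; lra.
(* Slack over speed; adding 1 keeps the denominator positive whatever the sign of [dotp (n i) d]. *)
exists ((b i - dotp (n i) w) / (1 + `|dotp (n i) d|)).
  by rewrite divr_gt0 ?subr_gt0 // ltr_wpDr.
move=> e /andP[e0]; rewrite ler_pdivlMr ?ltr_wpDr // => eb _.
rewrite dotp_ray.
have : e * dotp (n i) d <= e * `|dotp (n i) d| by rewrite ler_pM2l // ler_norm.
by move: eb; rewrite mulrDr mulr1; lra.
Qed.

Lemma strict_core z : (forall i, dotp (n i) z < b i) -> core polyhedron z.
Proof.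
move=> zb d; have [i _|i _|e e0 eP] := @small_step setT z d; first exact: ltW.
  by left.
by exists e => // i; exact: eP.
Qed.

(* A member of a minimal subsystem is violated by some y satisfying all the others; the
   segment from an interior point to y leaves the polyhedron through the relative
   interior of the corresponding facet. *)
Lemma facet_subsystem {z} : core polyhedron z ->
  exists J : {set I},
    (forall x, (forall i, i \in J -> dotp (n i) x <= b i) -> polyhedron x) /\
    forall i, i \in J -> n i != [ffun=> 0] /\
      is_facet polyhedron (fun x => polyhedron x /\ dotp (n i) x = b i).
Proof.
move=> cz.
pose P := [pred J : {set I} |
  `[< forall x, (forall i, i \in J -> dotp (n i) x <= b i) -> polyhedron x >]].
have PT : P setT by apply/asboolP => x xb i; apply: xb.
have [J /minsetP[/asboolP PJ minJ] _] := minset_exists PT.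
have zb i : n i != [ffun=> 0] -> dotp (n i) z < b i.
  by apply: core_strict cz _ => x; apply.
have Qz := core_mem _ _ cz.
have viol i : i \in J -> exists y, b i < dotp (n i) y /\
    forall j, j \in J -> j != i -> dotp (n j) y <= b j.
  move=> iJ; apply: contrapT => /forallNP H.
  have /minJ/(_ (subsetDl _ _)) JE : P (J :\ i).
    apply/asboolP => x xb; apply: PJ => j jJ.
    have [ji|ji] := eqVneq j i; last by apply: xb; rewrite !inE ji.
    rewrite ji leNgt; apply/negP => lt; apply: (H x); split=> // l lJ li.
    by apply: xb; rewrite !inE li.
  by move: iJ; rewrite -JE !inE eqxx.
have nz i : i \in J -> n i != [ffun=> 0].
  move=> /viol[y [yb _]]; apply/eqP => n0; have := Qz i; move: yb.
  by rewrite n0 !dotp0l => /lt_le_trans h /h; rewrite ltxx.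
exists J; split=> // i iJ; split; first exact: nz.
have [y [yi yJ]] := viol i iJ; have zi := zb i (nz i iJ).
(* The parameter at which the segment from [z] to [y] meets the hyperplane of constraint [i]. *)
pose t := (b i - dotp (n i) z) / (dotp (n i) y - dotp (n i) z).
have den : 0 < dotp (n i) y - dotp (n i) z by rewrite subr_gt0 (lt_trans zi).
have t0 : 0 < t by rewrite divr_gt0 // subr_gt0.
have t1 : t < 1 by rewrite ltr_pdivrMr // mul1r ltrD2r.
pose w : pt R U := [ffun l => t * y l + (1 - t) * z l].
have wi : dotp (n i) w = b i.
  by rewrite dotp_conv /t; field; rewrite gt_eqF.
have wJ j : j \in J -> j != i -> dotp (n j) w < b j.
  move=> jJ ji; rewrite dotp_conv.
  have := zb j (nz j jJ); have := yJ j jJ ji => yj zj.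
  have : t * dotp (n j) y <= t * b j by rewrite ler_pM2l.
  have : (1 - t) * dotp (n j) z < (1 - t) * b j by rewrite ltr_pM2l ?subr_gt0.
  by lra.
split; first by exists (n i), (b i); split=> // x; apply.
have [i1 _] := pt_neq0 _ (nz i iJ).
have : (0 < #|U|)%N by apply/card_gt0P; exists i1.
case cU: #|U| => [//|k] _; exists k; split.
  by rewrite -cU; exact: core_affdim cz.
apply: (relative_core_affdim (esym cU) (nz i iJ) (w := w) (b := b i)).
  by move=> x [].
move=> d d0; have [j jJ|j jJ|e e0 eP] := @small_step J w d.
- by have [->|ji] := eqVneq j i; [rewrite wi | exact/ltW/wJ].
- by have [->|ji] := eqVneq j i; [right; rewrite d0 | left; exact: wJ].
exists e => //; split; first exact: PJ.
by rewrite dotp_ray wi d0 mulr0 addr0.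
Qed.

(** Every facet lies on the hyperplane of some nonzero constraint [i] and, by dimension, spans it.
    By assumption the vertices lie on this hyperplane or on the parallel one at value [b i - 1]. *)
Lemma two_level_of_system {z} : core polyhedron z ->
  (forall v i, is_vertex polyhedron v ->
    dotp (n i) v = b i \/ dotp (n i) v = b i - 1) ->
  two_level polyhedron.
Proof.
move=> cz vb F [[a [beta [Qa FE]]] [k [[Qk nQk] [[v [Fv iv]] nFk]]]].
have [QU _] := core_affdim cz.
have kU : k.+1 = #|U|.
  apply/eqP; rewrite eqn_leq (affdim_ge_card Qk) /= leqNgt; apply/negP => lt.
  by apply: nQk; apply: affdim_ge_le lt QU.
have vQ i : polyhedron (v i) by have /FE[] := Fv i.
have va i : dotp a (v i) = beta by have /FE[] := Fv i.
have a0 : a != [ffun=> 0].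
  apply/eqP => a0; apply: nFk; case: Qk => u [Qu iu]; exists u; split=> // i.
  by apply/FE; split=> //; rewrite -(va ord0) a0 !dotp0l.
pose u : pt R U := [ffun j => k.+1%:R^-1 * \sum_i v i j].
have uE c : dotp c u = k.+1%:R^-1 * \sum_i dotp c (v i).
  rewrite /dotp exchange_big mulr_sumr; apply: eq_bigr => j _ /=.
  by rewrite ffunE -mulr_sumr mulrCA.
have k0 : 0 < k.+1%:R^-1 :> R by rewrite invr_gt0 ltr0n.
have avg (r : R) : k.+1%:R^-1 * \sum_(i < k.+1) r = r.
  by rewrite sumr_const card_ord -[r *+ _]mulr_natl mulKf ?pnatr_eq0.
(* Otherwise the barycentre u of the v_i satisfies every constraint strictly, and one
   can move from u in the direction a, contradicting the validity of a x <= beta. *)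
have [i [ni vi]] : exists i, n i != [ffun=> 0] /\ forall j, dotp (n i) (v j) = b i.
  apply: contrapT => /forallNP H.
  have ub i : dotp (n i) u <= b i.
    by rewrite uE -[leRHS]avg ler_pM2l // ler_sum // => j _; exact: vQ.
  have us i : n i != [ffun=> 0] -> dotp (n i) u < b i.
    move=> ni; rewrite lt_neqAle ub andbT; apply/eqP => eqi; apply: (H i); split=> // j.
    apply/eqP; rewrite eq_le vQ /= leNgt; apply/negP => lt.
    suff : dotp (n i) u < b i by rewrite eqi ltxx.
    rewrite uE -[ltRHS]avg ltr_pM2l // (bigD1 j) //= [ltRHS](bigD1 j) //=.
    by rewrite ltr_leD // ler_sum // => l _; exact: vQ.
  have [i _//|i _|e e0 eP] := @small_step setT u a.
    have [->|/us] := eqVneq (n i) [ffun=> 0]; last by left.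
    by right; rewrite dotp0l.
  have := Qa (ray u a e) (fun i => eP i (in_setT i)).
  rewrite dotp_ray uE (eq_bigr (fun=> beta)) // avg gerDl.
  by rewrite leNgt mulr_gt0 // dotp_gt0.
have hull := hyperplane_aff_hull kU ni v Fv iv vi.
(* Subtracting this vector raises the value of [dotp (n i)] by exactly 1. *)
exists [ffun j => - (n i j / dotp (n i) (n i))] => x xV.
have [xi|xi] := vb x i xV; [left|right]; apply: hull => //.
rewrite /dotp; under eq_bigr do rewrite ffunE ffunE opprK mulrDr mulrA.
rewrite big_split /= -mulr_suml -/(dotp _ _) -/(dotp _ _) xi divff ?subrK //.
by rewrite gt_eqF // dotp_gt0.
Qed.
End System.
End FiniteSystems.

(** * Transport of vertices and interior points along affine isomorphisms *)

Section AffineTransport.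
Context {R : realType} {U V : finType}.
Variables (A : V -> U -> R) (c : V -> R).
Variables (Q1 : pt R U -> Prop) (Q2 : pt R V -> Prop).
Hypothesis f_bij : bijective (affmap A c).
Hypothesis Q2E : forall y, Q2 y <-> exists2 x, Q1 x & affmap A c x = y.

Lemma affmap_memE x : Q1 x <-> Q2 (affmap A c x).
Proof.
split=> [Qx|/Q2E[x' Qx' /(bij_inj f_bij)<-//]].
by apply/Q2E; exists x.
Qed.

Lemma affmap_conv (x y : pt R U) (t : R) :
  affmap A c [ffun i => t * x i + (1 - t) * y i] =
  [ffun j => t * affmap A c x j + (1 - t) * affmap A c y j].
Proof.
apply/ffunP => j; rewrite !ffunE.
rewrite (eq_bigr (fun i => t * (A j i * x i) + (1 - t) * (A j i * y i))).
  by rewrite big_split /= -!mulr_sumr; ring.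
by move=> i _; rewrite ffunE; ring.
Qed.

Lemma is_vertex_affmap v : is_vertex Q1 v -> is_vertex Q2 (affmap A c v).
Proof.
case=> Qv vE; split; first exact/affmap_memE.
move=> _ _ t /Q2E[x Qx <-] /Q2E[y Qy <-] t01.
by rewrite -affmap_conv => /(bij_inj f_bij)/vE->.
Qed.

Lemma core_affmap z : core Q1 z -> core Q2 (affmap A c z).
Proof.
move=> cz d; have [g _ fK] := f_bij.
(* The preimage of [d] under the linear part: the affine map sends [d'] to [d + c]. *)
pose d' : pt R U := [ffun i => g [ffun j => d j + c j] i].
have d'E j : \sum_i A j i * d' i = d j.
  have /ffunP/(_ j) := fK [ffun j => d j + c j].
  rewrite !ffunE => /addIr <-; apply: eq_bigr => i _.
  by rewrite ffunE.
have [e e0 Qe] := cz d'; exists e => //; move/affmap_memE: Qe.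
congr Q2; apply/ffunP => j; rewrite !ffunE.
under eq_bigr do rewrite ffunE mulrDr mulrCA.
by rewrite big_split /= -mulr_sumr d'E; ring.
Qed.

Lemma dotp_affmap (n : pt R V) x :
  dotp n (affmap A c x) =
  dotp [ffun i => \sum_j n j * A j i] x + \sum_j n j * c j.
Proof.
rewrite /dotp; under eq_bigr do rewrite ffunE mulrDr mulr_sumr.
rewrite big_split exchange_big /=; congr (_ + _); apply: eq_bigr => i _.
by rewrite ffunE mulr_suml; apply: eq_bigr => j _; rewrite mulrA.
Qed.
End AffineTransport.

Lemma affmap_comp {R : realType} {U V W : finType} (A : V -> U -> R) (c : V -> R)
    (A' : W -> V -> R) (c' : W -> R) (x : pt R U) :
  affmap A' c' (affmap A c x) =
  affmap (fun k i => \sum_j A' k j * A j i) (fun k => \sum_j A' k j * c j + c' k) x.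
Proof.
apply/ffunP => k; rewrite !ffunE addrA; congr (_ + _).
under eq_bigr do rewrite ffunE mulrDr mulr_sumr.
rewrite big_split exchange_big /=; congr (_ + _); apply: eq_bigr => i _.
by rewrite mulr_suml; apply: eq_bigr => j _; rewrite mulrA.
Qed.

Lemma aff_isomorphic_trans {R : realType} {U V W : finType} (Q1 : pt R U -> Prop)
    (Q2 : pt R V -> Prop) (Q3 : pt R W -> Prop) :
  aff_isomorphic Q1 Q2 -> aff_isomorphic Q2 Q3 -> aff_isomorphic Q1 Q3.
Proof.
move=> [A [c [fb Q2E]]] [A' [c' [gb Q3E]]].
exists (fun k i => \sum_j A' k j * A j i), (fun k => \sum_j A' k j * c j + c' k).
split; first by apply: (eq_bij (bij_comp gb fb)) => x; exact: affmap_comp.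
move=> y; rewrite Q3E; split=> [[_ /Q2E[x Qx <-] <-]|[x Qx <-]].
  by exists x; rewrite // affmap_comp.
by exists (affmap A c x); [apply/Q2E; exists x | rewrite affmap_comp].
Qed.

(** Renaming coordinates is itself affine. This identifies the subtype of unmarked elements of a
    bounded poset with the poset it came from. *)
Lemma aff_isomorphic_reindex {R : realType} {U V W : finType} (g : W -> V)
    (Q1 : pt R U -> Prop) (Q2 : pt R V -> Prop) (Q3 : pt R W -> Prop) :
  bijective g -> (forall y : pt R V, Q3 [ffun w => y (g w)] <-> Q2 y) ->
  aff_isomorphic Q1 Q2 -> aff_isomorphic Q1 Q3.
Proof.
move=> [g' gK Kg] Q3E [A [c [[f' fK Kf] Q2E]]].
exists (fun w => A (g w)), (fun w => c (g w)).
have fE x : affmap (fun w => A (g w)) (fun w => c (g w)) x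
    = [ffun w => affmap A c x (g w)] by apply/ffunP => w; rewrite !ffunE.
pose p (y : pt R W) : pt R V := [ffun v => y (g' v)].
have pE y : [ffun w => p y (g w)] = y.
  by apply/ffunP => w; rewrite !ffunE gK.
have Ep (y : pt R V) : p [ffun w => y (g w)] = y.
  by apply/ffunP => v; rewrite !ffunE Kg.
split; first by exists (fun y => f' (p y)) => [x|y]; rewrite fE ?Ep ?fK // Kf pE.
move=> y; rewrite -[in X in X <-> _](pE y) Q3E Q2E.
split=> -[x Qx xy]; exists x => //; first by rewrite fE xy pE.
by rewrite -xy fE Ep.
Qed.

(** * Saturated chains in finite posets *)

Section Posets.
Context {T : finType} (le : rel T).
Hypothesis poset : is_poset le.

Lemma is_poset_dual : is_poset (fun x y => le y x).
Proof.
case: poset => lexx [leA leT]; split=> //; split=> [x y|y x z yx zy].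
  by rewrite andbC => /leA.
exact: leT zy yx.
Qed.

Lemma minimal_below (P : pred T) x : P x ->
  exists2 m, P m & le m x /\ forall q, P q -> le q m -> q = m.
Proof.
case: poset => lexx [leA leT] Px.
have Px' : [pred p | P p && le p x] x by rewrite /= Px lexx.
(* An element of [P] below [x] with the fewest elements below it is minimal in [P]. *)
case: (arg_minnP (fun p => #|[set r | le r p]|) Px') => m /andP[Pm mx] mmin.
exists m => //; split=> // q Pq qm; apply: leA; rewrite qm /=.
have sub : [set s | le s q] \subset [set s | le s m].
  by apply/subsetP => s; rewrite !inE => /leT; apply.
have /eqP E : [set s | le s q] == [set s | le s m].
  by rewrite eqEcard sub mmin //= Pq (leT _ _ _ qm mx).
have : m \in [set s | le s m] by rewrite inE.
by rewrite -E inE.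
Qed.

Lemma ltp_trans : transitive (ltp le).
Proof.
case: poset => lexx [leA leT] y x z /andP[xy nxy] /andP[yz nyz].
rewrite /ltp (leT _ _ _ xy yz); apply/eqP => xz; subst z.
by move/eqP: nxy; apply; apply: leA; rewrite xy.
Qed.

(** A minimal element [z] of the half-open interval from [x] (excluded) to [y] covers [x], and the
    interval from [z] to [y] is smaller. *)
Lemma covers_path x y : le x y ->
  exists2 s, path (covers le) x s & last x s = y.
Proof.
case: poset => lexx [leA leT].
have [n] := ubnP #|[set z | ltp le x z && le z y]|.
elim: n x => // n IH x; rewrite ltnS => xn xy.
have [<-|nxy] := eqVneq x y; first by exists [::].
have [|z /andP[xz zy] [_ zmin]] := minimal_below [pred z | ltp le x z && le z y] y.
  by rewrite /= /ltp xy nxy lexx.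
have cxz : covers le x z.
  rewrite /covers xz negb_exists; apply/forallP => r; apply/negP => /andP[xr].
  case/andP => rz /eqP; apply; apply: zmin => //=.
  by rewrite xr (leT _ _ _ rz zy).
have [||s cs ls] := IH z => //; last by exists (z :: s) => //=; rewrite cxz.
apply: leq_trans xn; apply/proper_card/properP; split.
  apply/subsetP => r; rewrite !inE => /andP[zr ->]; rewrite andbT.
  exact: ltp_trans xz zr.
by exists z; rewrite !inE ?xz ?zy // /ltp eqxx andbF.
Qed.

Lemma covers_refine x s : path (ltp le) x s ->
  exists s', [/\ path (covers le) x s', last x s' = last x s & {subset s <= s'}].
Proof.
elim: s x => [|y s IH] x /=; first by exists [::].
case/andP => /andP[xy nxy] /IH[s2 [c2 l2 sub2]].
have [s1 c1 l1] := covers_path _ _ xy; exists (s1 ++ s2); split.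
- by rewrite cat_path c1 l1.
- by rewrite last_cat l1.
move=> z; rewrite inE mem_cat => /predU1P[->|/sub2->]; last by rewrite orbT.
have := mem_last x s1; rewrite l1 inE eq_sym (negPf nxy) /= => ->.
by [].
Qed.

Lemma pairwise_ltp_chain s : pairwise (ltp le) s ->
  forall x y, x \in s -> y \in s -> le x y || le y x.
Proof.
case: poset => lexx _; elim: s => //= z s IH /andP[/allP zs /IH{}IH] x y.
rewrite !inE => /predU1P[->|xs] /predU1P[->|ys]; last exact: IH.
- by rewrite lexx.
- by have /andP[->] := zs _ ys.
by have /andP[->] := zs _ xs; rewrite orbT.
Qed.

Lemma chain_enum (C : {set T}) : is_chain le C ->
  exists2 s, s =i C & pairwise (ltp le) s.
Proof.
case: poset => lexx [leA leT] Cc; exists (sort le (enum C)).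
  by move=> x; rewrite mem_sort mem_enum.
have so : sorted le (sort le (enum C)).
  apply: (sort_sorted_in (P := [in C])); first by move=> x y xC yC; exact: Cc.
  by apply/allP => x; rewrite mem_enum.
have : uniq (sort le (enum C)) by rewrite sort_uniq enum_uniq.
rewrite uniq_pairwise; move: so; rewrite sorted_pairwise // => p1 p2.
by rewrite /ltp (pairwise_relI le) p1.
Qed.

Lemma marked_chain_pairwise (M : {set T}) a s b :
  marked_chain le M a s b -> pairwise (ltp le) (a :: rcons s b).
Proof.
case=> _ _ _ p c; rewrite -(sorted_pairwise ltp_trans) /=.
apply: (sub_path (e := covers le)); first by move=> x y /andP[].
by rewrite rcons_path p.
Qed.

Lemma marked_chain_bounds (M : {set T}) a s b p : marked_chain le M a s b ->
  p \in s -> le a p /\ le p b.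
Proof.
move/marked_chain_pairwise; rewrite /= pairwise_rcons => /andP[/allP h /andP[/allP h' _]].
move=> ps; have /h/andP[-> _] : p \in rcons s b by rewrite mem_rcons inE ps orbT.
by have /h'/andP[-> _] := ps.
Qed.

Lemma marked_chain_ltp (M : {set T}) a s b : marked_chain le M a s b -> ltp le a b.
Proof.
move/marked_chain_pairwise => /= /andP[/allP h _].
by apply: h; rewrite mem_rcons inE eqxx.
Qed.

Lemma marked_chain_is_chain (M : {set T}) a s b x y : marked_chain le M a s b ->
  x \in s -> y \in s -> le x y || le y x.
Proof.
move/marked_chain_pairwise/pairwise_ltp_chain => h xs ys.
by apply: h; rewrite inE mem_rcons inE ?xs ?ys !orbT.
Qed.
End Posets.

(** * Vertices of chain polytopes, and why these polytopes are 2-level *)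

Section ChainPolytope.
Context {R : realType} {Q : finType} (le : rel Q).
Hypothesis poset : is_poset le.
Implicit Types (v x y : pt R Q) (C : {set Q}).

Lemma chain1 c : is_chain le [set c].
Proof. by case: poset => leQxx _ d e /set1P-> /set1P->; rewrite leQxx. Qed.

Lemma chain_polytope_le1 x c : chain_polytope le x -> x c <= 1.
Proof. by case=> _ /(_ _ (chain1 c)); rewrite big_set1. Qed.

Lemma chain_sum_le x C :
  chain_polytope le x -> is_chain le C -> \sum_(c in C) x c <= 1.
Proof. by case=> _; apply. Qed.

(* Unless v is the indicator of the antichain A of minimal elements of its support, it
   is a proper convex combination of that indicator and another point of the polytope. *)
Lemma chain_polytope_vertex v : is_vertex (chain_polytope le) v ->
  forall c, v c = 0 \/ v c = 1.
Proof.
case: (poset) => leQxx [leQ_anti leQ_trans] [Qv ext].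
have v0 c : 0 <= v c by case: Qv.
have v1 c : v c <= 1 by exact: chain_polytope_le1.
pose A := [set p | (0 < v p) && [forall q, (0 < v q) ==> le q p ==> (q == p)]].
have below q : 0 < v q -> exists2 p, p \in A & le p q.
  move=> vq; have [p vp [pq pmin]] := minimal_below le poset (fun p => 0 < v p) q vq.
  exists p => //; rewrite inE vp; apply/forallP => r.
  by apply/implyP => vr; apply/implyP => /(pmin _ vr)->.
have Amin p q : p \in A -> 0 < v q -> le q p -> q = p.
  rewrite inE => /andP[_ /forallP/(_ q)/implyP h] vq qp.
  by apply/eqP; apply: (implyP (h vq)).
have [[c1 vc1]|v_le0] := pselect (exists c, 0 < v c); last first.
  move=> c; left; apply/eqP; rewrite eq_le v0 andbT leNgt; apply/negP => vc.
  by apply: v_le0; exists c.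
have [p1 p1A _] := below _ vc1.
case: (arg_minP (P := fun p => p \in A) v p1A) => p0 p0A p0min.
(* [t] is the smallest value of [v] on [A]; it becomes the weight of the indicator of [A]. *)
set t := v p0 in p0min.
have t0 : 0 < t by move: p0A; rewrite inE => /andP[].
have pair p q : p \in A -> 0 < v q -> p != q -> le p q -> v p + v q <= 1.
  move=> pA vq pq lepq; have := @chain_sum_le v [set p; q] Qv.
  rewrite big_setU1 ?inE //= big_set1; apply.
  by move=> a b /set2P[]-> /set2P[]->; rewrite ?leQxx ?lepq ?orbT.
move=> c; have [vc|] := ltP 0 (v c); last first.
  by move=> vc; left; apply/eqP; rewrite eq_le vc v0.
(* If [t >= 1], then a member of [A] strictly below [c] would form with [c] a chain of sum above 1,
   so [c] is itself in [A]. *)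
right; have [t1|t1] := leP 1 t.
  have [p pA pc] := below c vc.
  have vp : 1 <= v p by apply: le_trans (p0min p pA).
  have [E|npc] := eqVneq p c; first by apply/eqP; rewrite eq_le v1 -E.
  by have := pair p c pA vc npc pc; lra.
pose x : pt R Q := [ffun p => (p \in A)%:R].
(* Chosen so that [v = t x + (1 - t) y]. *)
pose y : pt R Q := [ffun p => (v p - t * x p) / (1 - t)].
have t1' : 1 - t != 0 by rewrite gt_eqF // subr_gt0.
have Achain C : is_chain le C -> \sum_(p in C) x p <= 1 /\
    ((exists2 p, p \in C & p \in A) -> \sum_(p in C) x p = 1).
  move=> Cc; have [[p pC pA]|nA] := pselect (exists2 p, p \in C & p \in A).
    suff E : \sum_(p in C) x p = 1 by rewrite E.
    rewrite (bigD1 p) //= ffunE pA big1 ?addr0 // => q /andP[qC qp]; rewrite ffunE.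
    case qA: (q \in A) => //; case/eqP: qp.
    have vp : 0 < v p by move: pA; rewrite inE => /andP[].
    have vq : 0 < v q by move: qA; rewrite inE => /andP[].
    by have /orP[/Amin->|/Amin->] := Cc _ _ qC pC.
  rewrite big1; first by split=> // /nA.
  move=> p pC; rewrite ffunE; case pA: (p \in A) => //.
  by case: nA; exists p.
have Qx : chain_polytope le x.
  by split=> [p|C /Achain[]//]; rewrite ffunE ler0n.
have Qy : chain_polytope le y.
  split=> [p|C Cc].
    rewrite ffunE divr_ge0 ?subr_ge0 ?(ltW t1) // ffunE.
    by case: (boolP (p \in A)) => [/p0min|_]; rewrite ?mulr1 ?mulr0.
  under eq_bigr do rewrite ffunE.
  rewrite -mulr_suml ler_pdivrMr ?subr_gt0 // mul1r sumrB -mulr_sumr.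
  have [mA|nA] := pselect (exists2 p, p \in C & p \in A).
    by rewrite (Achain _ Cc).2 // mulr1 lerB // chain_sum_le.
  rewrite [X in t * X]big1 ?mulr0 ?subr0; last first.
    move=> p pC; rewrite ffunE; case pA: (p \in A) => //.
    by case: nA; exists p.
  (* The chain [C] misses [A]. Its part [D] in the support of [v] can be prolonged downwards by some
     [p] in [A], and [v p >= t] leaves at most [1 - t] for [D]. *)
  pose D := C :&: [set p | 0 < v p].
  have -> : \sum_(p in C) v p = \sum_(p in D) v p.
    rewrite [LHS](bigID [in D]) /= [X in _ + X]big1 ?addr0; last first.
      move=> p; rewrite !inE negb_and => /andP[-> /=]; rewrite -leNgt => vp.
      by apply/eqP; rewrite eq_le vp v0.
    by apply: eq_bigl => p; rewrite !inE; case: (p \in C).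
  have [D0|[q0 q0D]] := set_0Vmem D.
    by rewrite D0 big_set0 subr_ge0 ltW.
  have [q qD [_ qmin]] := minimal_below le poset [in D] q0 q0D.
  have DC r : r \in D -> r \in C by rewrite inE => /andP[].
  have qlow r : r \in D -> le q r.
    move=> rD; have /orP[//|rq] := Cc _ _ (DC _ qD) (DC _ rD).
    by rewrite (qmin r rD rq) leQxx.
  have [p pA pq] : exists2 p, p \in A & le p q.
    by apply: below; move: qD; rewrite !inE => /andP[].
  have pD : p \notin D by apply/negP => /DC pC; apply: nA; exists p.
  have := @chain_sum_le v (p |: D) Qv.
  rewrite big_setU1 //= => h; have := p0min p pA.
  suff /h : is_chain le (p |: D) by rewrite -/t; lra.
  move=> a b /setU1P[->|aD] /setU1P[->|bD].
  - by rewrite leQxx.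
  - by rewrite (leQ_trans _ _ _ pq (qlow _ bD)).
  - by rewrite (leQ_trans _ _ _ pq (qlow _ aD)) orbT.
  by apply: Cc; exact: DC.
have xy : x = y.
  apply: (ext x y t) => //; first by rewrite t0 t1.
  by apply/ffunP => p; rewrite !ffunE mulrCA divff // mulr1 addrC subrK.
(* From [x = y] follows [v = x], and [x c] cannot be 0 because [v c > 0]. *)
have := congr1 (fun f : pt R Q => f c) xy; rewrite !ffunE.
by case: (c \in A) => /= /(congr1 ( *%R^~ (1 - t))); rewrite divfK //; lra.
Qed.

Definition chain_nrm (i : Q + {set Q}) : pt R Q :=
  match i with
  | inl c => [ffun d => - (d == c)%:R]
  | inr C => if `[< is_chain le C >] then [ffun d => (d \in C)%:R] else [ffun=> 0]
  end.

(* A set that is not a chain contributes the void constraint 0 <= 1. *)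
Definition chain_rhs (i : Q + {set Q}) : R := if i is inr _ then 1 else 0.

Lemma chain_polytopeE x :
  chain_polytope le x <-> @polyhedron R Q _ chain_nrm chain_rhs x.
Proof.
split=> [[x0 xC] [c|C]|h] /=.
- by rewrite dotp_opp_unit oppr_le0.
- case: asboolP => [/xC|_]; last by rewrite dotp0l.
  by rewrite -dotp_indicator.
split=> [c|C Cc].
  by have := h (inl c); rewrite /= dotp_opp_unit oppr_le0.
by have := h (inr C); rewrite /= asboolT // dotp_indicator.
Qed.

(** At a 0/1 point a chain sum bounded by 1 is 0 or 1. A set that is not a chain has value 0, the
    second level of its void constraint. *)
Lemma chain_vertex_values v i : is_vertex (chain_polytope le) v ->
  dotp (chain_nrm i) v = chain_rhs i \/ dotp (chain_nrm i) v = chain_rhs i - 1.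
Proof.
move=> vV; have v01 := chain_polytope_vertex v vV; have [Qv _] := vV.
case: i => [c|C] /=.
  by rewrite dotp_opp_unit; case: (v01 c) => ->; [left|right]; lra.
case: asboolP => [Cc|_]; last by right; rewrite dotp0l subrr.
rewrite dotp_indicator subrr.
have := chain_sum_le v C Qv Cc.
have [[c cC c1] sC|h _] := pselect (exists2 c, c \in C & v c = 1).
  left; apply/eqP; rewrite eq_le sC (bigD1 c) //= c1 lerDl.
  by apply: sumr_ge0 => d _; case: Qv.
right; rewrite big1 // => c cC; have [//|c1] := v01 c.
by case: h; exists c.
Qed.

(** Pulling the chain inequalities back along the isomorphism presents [Q1] itself by a system with
    two values at each vertex, so only vertices need transporting, not facets. *)
Lemma two_level_iso_chain_polytope (U : finType) (Q1 : pt R U -> Prop) z :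
  core Q1 z -> aff_isomorphic Q1 (chain_polytope le) -> two_level Q1.
Proof.
move=> cz [A [c [f_bij QE]]].
pose n i := [ffun j => \sum_k chain_nrm i k * A k j] : pt R U.
pose b i := chain_rhs i - \sum_k chain_nrm i k * c k.
have nE i (x : pt R U) :
    dotp (n i) x = dotp (chain_nrm i) (affmap A c x) - \sum_k chain_nrm i k * c k.
  by rewrite dotp_affmap addrK.
have Q1E : Q1 = @polyhedron R U _ n b.
  apply/funext => x; apply/propext.
  rewrite (affmap_memE _ _ _ _ f_bij QE) chain_polytopeE.
  by split=> h i; have := h i; rewrite nE /b lerD2r.
rewrite Q1E in cz *; apply: two_level_of_system cz _ => w i vV.
rewrite nE /b; have vV2 : is_vertex (chain_polytope le) (affmap A c w).
  by apply: (is_vertex_affmap _ _ Q1) => //; rewrite Q1E.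
by have [->|->] := chain_vertex_values _ i vV2; [left|right]; ring.
Qed.
End ChainPolytope.

(** * Extreme marks, and extension of chains to saturated marked chains *)

Section MarkedPosets.
Context {R : realType} {T : finType}.

(* The marked element below p of largest label, taken maximal in the poset so that no
   marked element separates it from p; upper marks are lower marks for the dual poset. *)
Definition lower_mark (le : rel T) (M : {set T}) (lam : T -> R) (p a : T) : Prop :=
  [/\ a \in M, le a p, forall m, m \in M -> le m p -> lam m <= lam a
    & forall m, m \in M -> le a m -> le m p -> m = a].

Definition upper_mark (le : rel T) (M : {set T}) (lam : T -> R) : T -> T -> Prop :=
  lower_mark (fun x y => le y x) M (fun x => - lam x).

Lemma marked_poset_dual (le : rel T) M (lam : T -> R) : marked_poset le M lam ->
  marked_poset (fun x y => le y x) M (fun x => - lam x).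
Proof.
case=> po mn mx mon; split=> //; first exact: is_poset_dual.
by move=> a b aM bM ba; rewrite lerN2; exact: mon.
Qed.

Lemma lower_mark_exists (le : rel T) M (lam : T -> R) p : marked_poset le M lam ->
  exists a, lower_mark le M lam p a.
Proof.
case=> po mn mx mon; case: (po) => lexx [leA leT].
have [//|a0 _ [a0p a0min]] := minimal_below _ po predT p.
have a0M : a0 \in M by apply: mn => q; exact: a0min.
have P0 : [pred a | (a \in M) && le a p] a0 by rewrite /= a0M.
case: (arg_maxP lam P0) => a1 /andP[a1M a1p] a1max.
pose P := [pred a | [&& a \in M, le a p & lam a == lam a1]].
have [|a /and3P[aM ap /eqP al] [_ amin]] := minimal_below _ (is_poset_dual _ po) P a1.
  by rewrite /= a1M a1p eqxx.
have amax m : m \in M -> le m p -> lam m <= lam a.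
  by move=> mM mp; rewrite al; apply: a1max; rewrite /= mM.
exists a; split=> // m mM am mp; apply: amin => //=.
by rewrite mM mp -al eq_le amax //= mon.
Qed.

Lemma upper_mark_exists (le : rel T) M (lam : T -> R) p : marked_poset le M lam ->
  exists b, upper_mark le M lam p b.
Proof. by move/marked_poset_dual/(lower_mark_exists _ _ _ p). Qed.

Section Extension.
Context {le : rel T} {M : {set T}} {lam : T -> R}.
Hypothesis mp : marked_poset le M lam.

(** Refine [C], prolonged by the lower mark [a] of its bottom and the upper mark [b] of its top, to
    a path of covers. The choice of [a] and [b] excludes marked elements below or above [C] on this
    path, and the last hypothesis excludes those in between. *)
Lemma chain_extension {C : {set T}} : C != set0 -> is_chain le C ->
  (forall p, p \in C -> p \notin M) ->
  (forall p q m, p \in C -> q \in C -> m \in M -> le p m -> le m q -> False) ->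
  exists a s b, [/\ marked_chain le M a s b, {subset C <= s},
    exists2 p, p \in C & lower_mark le M lam p a &
    exists2 q, q \in C & upper_mark le M lam q b].
Proof.
case: (mp) => po _ _ mon; case: (po) => lexx [leA leT].
case/set0Pn => c0 c0C Cc CM sep.
have [s sC ps] := chain_enum _ po _ Cc.
have /hasP/= : has [in C] s by apply/hasP; exists c0; rewrite ?sC.
case: s sC ps => [_ _ []//|p0 s'] sC ps _; set s := p0 :: s' in sC ps.
set q0 := last p0 s'.
have p0C : p0 \in C by rewrite -sC mem_head.
have q0C : q0 \in C by rewrite -sC /q0 mem_last.
have p0le q : q \in C -> le p0 q.
  rewrite -sC inE => /predU1P[->//|qs]; move: ps => /= /andP[/allP/(_ _ qs)].
  by case/andP.
have q0le q : q \in C -> le q q0.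
  rewrite -sC => qs; have : pairwise (ltp le) (rcons (belast p0 s') q0).
    by rewrite -lastI.
  rewrite pairwise_rcons => /andP[/allP h _].
  by move: qs; rewrite /s lastI mem_rcons inE => /predU1P[->//|/h/andP[]].
have [a aL] := lower_mark_exists _ _ _ p0 mp; have [aM ap0 _ amax] := aL.
have [b bU] := upper_mark_exists _ _ _ q0 mp; have [bM q0b _ bmin] := bU.
have ltaC p : p \in C -> ltp le a p.
  move=> pC; rewrite /ltp (leT _ _ _ ap0 (p0le _ pC)).
  by apply: contraNneq (CM _ pC) => <-.
have ltCb p : p \in C -> ltp le p b.
  move=> pC; rewrite /ltp (leT _ _ _ (q0le _ pC) q0b).
  by apply: contraNneq (CM _ pC) => ->.
have : path (ltp le) a (rcons s b).
  rewrite rcons_path /= ltaC // ltCb // andbT.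
  by have := ps; rewrite -(sorted_pairwise (ltp_trans _ po)).
case/(covers_refine _ po) => t [tc tl tsub].
rewrite last_rcons in tl; case/lastP: t tc tl tsub => [|t b'].
  (* The refinement is not empty, since it contains [p0]. *)
  by move=> _ _ /(_ p0); rewrite mem_rcons !inE eqxx orbT => /(_ isT).
rewrite last_rcons => tc bb' tsub; subst b'.
have pw : pairwise (ltp le) (a :: rcons t b).
  rewrite -(sorted_pairwise (ltp_trans _ po)) /=.
  by apply: sub_path tc => x y /andP[].
have Ct : {subset C <= t}.
  move=> p pC; have : p \in rcons t b.
    by apply: tsub; rewrite mem_rcons in_cons sC pC orbT.
  rewrite mem_rcons in_cons => /predU1P[pb|//].
  by have := ltCb p pC; rewrite pb /ltp eqxx andbF.
have tM : all (fun p => p \notin M) t.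
  apply/allP => m mt; apply/negP => mM.
  have ltam : ltp le a m.
    by move: pw => /= /andP[/allP h _]; apply: h; rewrite mem_rcons inE mt orbT.
  have ltmb : ltp le m b.
    by move: pw; rewrite /= pairwise_rcons => /and3P[_ /allP h _]; exact: h.
  have cmp p : p \in C -> le p m || le m p.
    move=> /Ct pt; apply: (pairwise_ltp_chain _ po _ pw);
    by rewrite inE mem_rcons inE ?pt ?mt !orbT.
  have [mp0|nmp0] := boolP (le m p0).
    by case/andP: ltam => am /eqP; rewrite (amax m mM am mp0).
  have p0m : le p0 m by have := cmp _ p0C; rewrite (negPf nmp0) orbF.
  have [mq0|nmq0] := boolP (le m q0); first exact: sep p0C q0C mM p0m mq0.
  have q0m : le q0 m by have := cmp _ q0C; rewrite (negPf nmq0) orbF.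
  by case/andP: ltmb => mb /eqP; rewrite (bmin m mM mb q0m).
exists a, t, b; split=> //; [|by exists p0|by exists q0].
by move: tc; rewrite rcons_path => /andP[tc cb]; split.
Qed.

Lemma chain_through {p} : p \notin M -> exists a s b,
  [/\ marked_chain le M a s b, p \in s, lower_mark le M lam p a &
      upper_mark le M lam p b].
Proof.
case: (mp) => -[lexx [leA leT]] _ _ _ pM.
have [||_ /set1P-> //|q r m /set1P-> /set1P-> mM pm mp'|] := @chain_extension [set p].
- by apply/set0Pn; exists p; rewrite inE.
- by apply: chain1.
- by move/negP: pM; apply; rewrite (leA p m) ?pm.
move=> a [s [b [mc Cs [_ /set1P-> aL] [_ /set1P-> bU]]]].
by exists a, s, b; split=> //; apply: Cs; rewrite inE.
Qed.
End Extension.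
End MarkedPosets.

(** * The marked chain polytope as a finite system, and its rescaling to a chain polytope *)

Section MarkedChainPolytope.
Context {R : realType} {T : finType} {le : rel T} {M : {set T}} {lam : T -> R}.
Hypothesis mp : marked_poset le M lam.
Local Notation U := {p : T | p \notin M}.

Let po : is_poset le. Proof. by case: mp. Qed.

Lemma marked_chain_rhs_ge0 {a s b} : marked_chain le M a s b -> 0 <= lam b - lam a.
Proof.
move=> mc; case: (mp) => _ _ _ mon; case: (mc) => aM bM _ _ _.
by rewrite subr_ge0; apply: mon => //; case/andP: (marked_chain_ltp _ po _ _ _ _ mc).
Qed.

(** Constraints are indexed by two end points and a set, since sequences do not form a finite type.
    Chains with no unmarked element are left out: their inequality has zero normal and holds by
    monotonicity of [lam]. *)
Definition mcp_chain (i : T * T * {set U}) : Prop :=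
  exists s, [/\ marked_chain le M i.1.1 s i.1.2,
                i.2 = [set u | val u \in s] & i.2 != set0].

Definition mcp_nrm (i : U + T * T * {set U}) : pt R U :=
  match i with
  | inl c => [ffun d => - (d == c)%:R]
  | inr j => if `[< mcp_chain j >] then [ffun d => (d \in j.2)%:R] else [ffun=> 0]
  end.

(** Indices that are not chains get the strict void constraint [0 <= 1], so a strict marking makes
    all [inr] right-hand sides positive. *)
Definition mcp_rhs (i : U + T * T * {set U}) : R :=
  match i with
  | inl c => 0
  | inr j => if `[< mcp_chain j >] then lam j.1.2 - lam j.1.1 else 1
  end.

Lemma mcp_polyhedron : mcp le M lam = @polyhedron R U _ mcp_nrm mcp_rhs.
Proof.
apply/funext => x; apply/propext; split=> [[x0 xs] [c|[[a b] C]]|h] /=.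
- by rewrite dotp_opp_unit oppr_le0.
- case: asboolP => [[s /= [mc -> _]]|_]; last by rewrite dotp0l.
  rewrite dotp_indicator; apply: le_trans (xs a s b mc).
  by apply/eq_ler/eq_bigl => u; rewrite inE.
split=> [c|a s b mc].
  by have := h (inl c); rewrite /= dotp_opp_unit oppr_le0.
pose C := [set u : U | val u \in s].
have SE : \sum_(u | val u \in s) x u = \sum_(u in C) x u.
  by apply: eq_bigl => u; rewrite inE.
have [C0|Cn0] := eqVneq C set0.
  by rewrite SE C0 big_set0 (marked_chain_rhs_ge0 mc).
have := h (inr (a, b, C)); rewrite /= asboolT; last by exists s.
by rewrite dotp_indicator SE.
Qed.

Definition chain_face (a : T) (s : seq T) (b : T) (x : pt R U) : Prop :=
  mcp le M lam x /\ \sum_(u | val u \in s) x u = lam b - lam a.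

Lemma mcp_of_facets {z} : core (mcp le M lam) z -> forall x : pt R U,
  (forall u, 0 <= x u) ->
  (forall a s b (u : U), marked_chain le M a s b -> val u \in s ->
    is_facet (mcp le M lam) (chain_face a s b) ->
    \sum_(u | val u \in s) x u <= lam b - lam a) ->
  mcp le M lam x.
Proof.
move=> cz x x0 xf; rewrite mcp_polyhedron in cz.
have [J [JQ JF]] := facet_subsystem cz.
rewrite mcp_polyhedron; apply: JQ => -[c|[[a b] C]] /JF[nz fc] /=.
  by rewrite dotp_opp_unit oppr_le0.
move: nz fc; rewrite /=; case: asboolP => [ch|_]; last by rewrite eqxx.
move=> _; case: ch => s /= [mc CE /set0Pn[u uC]] fc.
have SE y : dotp [ffun d => (d \in C)%:R] y = \sum_(u | val u \in s) y u.
  by rewrite dotp_indicator; apply: eq_bigl => v; rewrite CE inE.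
rewrite SE; apply: (xf a s b u) => //; first by move: uC; rewrite CE inE.
rewrite mcp_polyhedron; move: fc; congr is_facet; apply/funext => y.
by rewrite /chain_face mcp_polyhedron SE.
Qed.

(** The all-ones direction leads from the origin into the polytope. Half of an admissible step
    satisfies every constraint strictly. *)
Lemma strict_mcp_core : strict_marking le M lam -> exists z, core (mcp le M lam) z.
Proof.
move=> st; rewrite mcp_polyhedron.
have rhs0 i : 0 <= mcp_rhs i.
  case: i => [//|[[a b] C]] /=; case: asboolP => // -[s /= [mc _ _]].
  exact: marked_chain_rhs_ge0 mc.
have rhs_gt0 j : 0 < mcp_rhs (inr j).
  rewrite /=; case: asboolP => // -[s [mc _ _]]; rewrite subr_gt0.
  by case: (mc) => aM bM _ _ _; apply: st => //; exact: marked_chain_ltp mc.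
have d0 (a : pt R U) : dotp a [ffun=> 0] = 0.
  by rewrite /dotp big1 // => i _; rewrite ffunE mulr0.
have [i _|i _|e e0 eP] := @small_step R U _ mcp_nrm mcp_rhs setT [ffun=> 0] [ffun=> 1].
- by rewrite d0.
- case: i => [c|j]; last by left; rewrite d0.
  by right; rewrite /= dotp_opp_unit ffunE lerN10.
exists (ray [ffun=> 0] [ffun=> 1] (e / 2)); apply: strict_core => i.
have := eP i (in_setT i); rewrite !dotp_ray !d0 !add0r.
case: i => [c|j].
  by rewrite /= dotp_opp_unit ffunE => _; lra.
by have := rhs_gt0 j; lra.
Qed.

Lemma lower_mark_uniq p a a' : lower_mark le M lam p a -> lower_mark le M lam p a' ->
  lam a = lam a'.
Proof.
move=> [aM ap am _] [aM' ap' am' _]; apply/eqP.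
by rewrite eq_le am // am'.
Qed.

Lemma upper_mark_uniq p b b' : upper_mark le M lam p b -> upper_mark le M lam p b' ->
  lam b = lam b'.
Proof.
move=> [bM pb bm _] [bM' pb' bm' _]; apply/eqP.
by rewrite eq_le -lerN2 bm //= -lerN2 bm'.
Qed.

Definition spike (u : U) (r : R) : pt R U := [ffun v => (v == u)%:R * r].

Lemma sum_spike (P : pred U) u r : \sum_(v | P v) spike u r v = (P u)%:R * r.
Proof.
rewrite (eq_bigr (fun v => (v == u)%:R * r)) => [|v _]; last by rewrite ffunE.
rewrite -mulr_suml; congr (_ * _); rewrite big_mkcond (bigD1 u) //= eqxx.
rewrite big1 ?addr0; first by case: (P u).
by move=> v /negPf->; case: (P v).
Qed.

Lemma mcp_coord_le x (u : U) a b : mcp le M lam x -> lower_mark le M lam (val u) a ->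
  upper_mark le M lam (val u) b -> x u <= lam b - lam a.
Proof.
case=> x0 xs aL bU; have [a' [s [b' [mc us aL' bU']]]] := chain_through mp (valP u).
rewrite (lower_mark_uniq _ _ _ aL aL') (upper_mark_uniq _ _ _ bU bU').
by apply: le_trans (xs _ _ _ mc); rewrite (bigD1 u) //= lerDl sumr_ge0.
Qed.

(** From an interior point the coordinate [u], already nonnegative, can still be increased, and it
    stays bounded by the spread. *)
Lemma marks_spread_gt0 {z} (u : U) a b : core (mcp le M lam) z ->
  lower_mark le M lam (val u) a -> upper_mark le M lam (val u) b ->
  0 < lam b - lam a.
Proof.
move=> cz aL bU; have [e e0 Qe] := cz [ffun=> 1]; have [z0 _] := core_mem _ _ cz.
apply: lt_le_trans (mcp_coord_le _ u _ _ Qe aL bU).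
by rewrite !ffunE mulr1 ltr_wpDl.
Qed.

(* The chain polytope in question is that of the unmarked elements, where u is below v
   when moreover no lower or upper mark changes between them. *)
Lemma mcp_iso_chain_polytope {z} : core (mcp le M lam) z ->
  (forall a s b (u : U), marked_chain le M a s b -> val u \in s ->
    is_facet (mcp le M lam) (chain_face a s b) ->
    mcp le M lam (spike u (lam b - lam a))) ->
  exists (Q : finType) (leQ : rel Q),
    is_poset leQ /\ aff_isomorphic (mcp le M lam) (chain_polytope leQ).
Proof.
move=> cz H; case: (po) => lexx [leA leT].
have /choice[lo loP] : forall p, exists a, lower_mark le M lam p a.
  by move=> p; exact: lower_mark_exists.
have /choice[hi hiP] : forall p, exists b, upper_mark le M lam p b.
  by move=> p; exact: upper_mark_exists.
pose al (u : U) := lam (lo (val u)); pose be (u : U) := lam (hi (val u)).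
pose h u := be u - al u.
have loM m u : m \in M -> le m (val u) -> lam m <= al u.
  by have [_ _ l _] := loP (val u); exact: l.
have hiM m u : m \in M -> le (val u) m -> be u <= lam m.
  by have [_ _ l _] := hiP (val u) => mM um; rewrite -lerN2; exact: l.
have h_gt0 u : 0 < h u by exact: (marks_spread_gt0 u _ _ cz).
(* The spike lies in the polytope, so [lam b - lam a <= h u]; as [lam a <= al u] and
   [be u <= lam b], equality holds in both. *)
have facetE a s b u : marked_chain le M a s b -> val u \in s ->
    is_facet (mcp le M lam) (chain_face a s b) -> al u = lam a /\ be u = lam b.
  move=> mc us fc.
  have := mcp_coord_le _ u _ _ (H _ _ _ u mc us fc) (loP _) (hiP _).
  rewrite -/(al u) -/(be u) ffunE eqxx mul1r.
  have [aM bM _ _ _] := mc; have [au ub] := marked_chain_bounds _ po _ _ _ _ _ mc us.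
  by have := loM _ _ aM au; have := hiM _ _ bM ub; split; lra.
pose leQ : rel U := fun u v => [&& le (val u) (val v), al u == al v & be u == be v].
have poQ : is_poset leQ.
  split=> [u|]; first by rewrite /leQ lexx !eqxx.
  split=> [u v /andP[/and3P[uv _ _] /and3P[vu _ _]]|v u w].
    by apply/val_inj/leA; rewrite uv.
  move=> /and3P[uv /eqP a1 /eqP b1] /and3P[vw /eqP a2 /eqP b2].
  by rewrite /leQ (leT _ _ _ uv vw) a1 a2 b1 b2 !eqxx.
have QchainE (C : {set U}) u v : is_chain leQ C -> u \in C -> v \in C ->
    al u = al v /\ be u = be v.
  move=> Cc uC vC.
  by have /orP[/and3P[_ /eqP-> /eqP->]|/and3P[_ /eqP-> /eqP->]] := Cc _ _ uC vC.
have Qchain_le x (C : {set U}) u : mcp le M lam x -> is_chain leQ C -> u \in C ->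
    \sum_(v in C) x v <= h u.
  move=> [x0 xs] Cc uC.
  have [|||_ _ m /imsetP[v vC ->] /imsetP[w wC ->] mM vm mw|] :=
      chain_extension mp (C := val @: C).
  - by apply/set0Pn; exists (val u); rewrite imset_f.
  - move=> _ _ /imsetP[v vC ->] /imsetP[w wC ->].
    by have /orP[/and3P[-> _ _]|/and3P[-> _ _]] := Cc _ _ vC wC; rewrite ?orbT.
  - by move=> _ /imsetP[v vC ->]; exact: (valP v).
  (* A marked [m] between [v] and [w] would give [be v <= lam m <= al w = al v], against
     [h v > 0]. *)
  - have := hiM _ _ mM vm; have := loM _ _ mM mw.
    have [-> _] := QchainE _ _ _ Cc wC vC.
    by have := h_gt0 v; rewrite /h; lra.
  move=> a [s [b [mc Cs [_ /imsetP[v vC ->] aL] [_ /imsetP[w wC ->] bU]]]].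
  have -> : h u = lam b - lam a.
    rewrite (lower_mark_uniq _ _ _ aL (loP _)) (upper_mark_uniq _ _ _ bU (hiP _)).
    rewrite -/(al v) -/(be w); have [_ ->] := QchainE _ _ _ Cc wC uC.
    by have [-> _] := QchainE _ _ _ Cc vC uC.
  apply: le_trans (xs _ _ _ mc).
  rewrite [leRHS](bigID [in C]) /= ler_wpDr ?sumr_ge0 //.
  apply/eq_ler/eq_bigl => c.
  by case cC: (c \in C); rewrite ?andbF // Cs ?imset_f.
exists U, leQ; split=> //.
pose A (v u : U) : R := (u == v)%:R / h u.
have AE x v : affmap A (fun=> 0) x v = x v / h v.
  rewrite ffunE addr0 (bigD1 v) //= /A eqxx mul1r mulrC big1 ?addr0 // => u /negPf->.
  by rewrite !mul0r.
have hn0 u : h u != 0 by rewrite gt_eqF.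
have fK (x : pt R U) : affmap A (fun=> 0) [ffun u => x u * h u] = x.
  by apply/ffunP => v; rewrite AE ffunE mulfK.
have Kf (x : pt R U) : [ffun u => affmap A (fun=> 0) x u * h u] = x.
  by apply/ffunP => v; rewrite ffunE AE divfK.
exists A, (fun=> 0); split.
  by exists (fun y : pt R U => [ffun u => y u * h u]) => x; [exact: Kf | exact: fK].
have sumE (y : pt R U) (C : {set U}) u : is_chain leQ C -> u \in C ->
    \sum_(v in C) y v * h v = (\sum_(v in C) y v) * h u.
  move=> Cc uC; rewrite mulr_suml; apply: eq_bigr => v vC.
  by have [al_ be_] := QchainE _ _ _ Cc uC vC; rewrite /h al_ be_.
move=> y; split=> [[y0 yC]|[x Qx <-]]; last first.
  have [x0 _] := Qx; split=> [c|C Cc]; first by rewrite AE divr_ge0 // ltW.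
  have [->|[u uC]] := set_0Vmem C; first by rewrite big_set0.
  rewrite -(ler_pM2r (h_gt0 u)) mul1r -sumE //.
  apply: le_trans (Qchain_le x C u Qx Cc uC).
  by apply/eq_ler/eq_bigr => v _; rewrite AE divfK.
exists [ffun u => y u * h u]; last exact: fK.
(* Only facet chains need checking, and by [facetE] these are chains of [leQ] with right-hand side
   [h u]. *)
apply: (mcp_of_facets cz) => [u|a s b u mc us fc].
  by rewrite ffunE mulr_ge0 // ltW.
pose C := [set v : U | val v \in s].
have Cc : is_chain leQ C.
  move=> v w; rewrite !inE => vs ws.
  have [av bv] := facetE _ _ _ _ mc vs fc; have [aw bw] := facetE _ _ _ _ mc ws fc.
  rewrite /leQ av bv aw bw !eqxx !andbT.
  exact: marked_chain_is_chain mc vs ws.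
have uC : u \in C by rewrite inE.
have -> : lam b - lam a = h u by rewrite /h; have [-> ->] := facetE _ _ _ _ mc us fc.
rewrite (eq_bigl [in C]) => [|v]; last by rewrite inE.
under eq_bigr do rewrite ffunE.
by rewrite (sumE y C u) // ler_piMl ?yC // ltW.
Qed.
End MarkedChainPolytope.
Arguments chain_face {R T} le M lam a s b x.

Lemma conv0_eq (R : realFieldType) (t x y : R) :
  0 = t * x + (1 - t) * y -> 0 < t < 1 -> 0 <= x -> 0 <= y -> x = y.
Proof.
move=> E /andP[t0 t1] x0 y0.
have tx : 0 <= t * x by rewrite mulr_ge0 // ltW.
have ty : 0 <= (1 - t) * y by rewrite mulr_ge0 // subr_ge0 ltW.
have /eqP : t * x = 0 by lra.
have /eqP : (1 - t) * y = 0 by lra.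
rewrite !mulf_eq0 subr_eq0 (gt_eqF t0) (gt_eqF t1) /=.
by move=> /eqP-> /eqP->.
Qed.

(** * Facet right-hand sides of a 2-level marked chain polytope *)

Section TwoLevelSpikes.
Context {R : realType} {T : finType} {le : rel T} {M : {set T}} {lam : T -> R}.
Hypothesis mp : marked_poset le M lam.
Local Notation U := {p : T | p \notin M}.

Lemma spike_mcp (u : U) a b : 0 <= lam b - lam a ->
  lower_mark le M lam (val u) a -> upper_mark le M lam (val u) b ->
  mcp le M lam (spike u (lam b - lam a)).
Proof.
move=> h0 [aM au aL _] [bM ub bU _]; split=> [v|a' s b' mc].
  by rewrite ffunE mulr_ge0 // ler0n.
rewrite sum_spike; have [us|_] := boolP (val u \in s); last first.
  by rewrite mul0r (marked_chain_rhs_ge0 mp mc).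
case: (mp) => po _ _ _; have [a'u ub'] := marked_chain_bounds _ po _ _ _ _ _ mc us.
case: (mc) => a'M b'M _ _ _; have := aL _ a'M a'u; have := bU _ b'M ub'.
by rewrite lerN2 mul1r; lra.
Qed.

(** The coordinate [u] is at its maximum and all others at their minimum 0, so neither can be
    averaged from two different values. *)
Lemma spike_vertex (u : U) a b : 0 <= lam b - lam a ->
  lower_mark le M lam (val u) a -> upper_mark le M lam (val u) b ->
  is_vertex (mcp le M lam) (spike u (lam b - lam a)).
Proof.
move=> h0 aL bU; split; first exact: spike_mcp.
move=> x y t Qx Qy /andP[t0 t1] /ffunP E; apply/ffunP => v.
have [x0 _] := Qx; have [y0 _] := Qy.
have xu := mcp_coord_le mp _ u _ _ Qx aL bU.
have yu := mcp_coord_le mp _ u _ _ Qy aL bU.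
have := E v; rewrite !ffunE; have [->|_] := eqVneq v u.
  rewrite mul1r; set h := lam b - lam a in xu yu *.
  by move=> Eu; have : t * (h - x u) = 0 /\ (1 - t) * (h - y u) = 0; nra.
by rewrite mul0r => /conv0_eq->; rewrite ?t0.
Qed.

Lemma origin_vertex : is_vertex (mcp le M lam) [ffun=> 0].
Proof.
split.
  split=> [u|a s b mc]; first by rewrite ffunE.
  by rewrite big1 ?(marked_chain_rhs_ge0 mp mc) // => u _; rewrite ffunE.
move=> x y t [x0 _] [y0 _] t01 /ffunP E; apply/ffunP => v.
by have := E v; rewrite !ffunE => /conv0_eq->.
Qed.

Lemma aff_hull_sum (F : pt R U -> Prop) (P : pred U) (r : R) :
  (forall x, F x -> \sum_(u | P u) x u = r) ->
  forall x, aff_hull F x -> \sum_(u | P u) x u = r.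
Proof.
move=> Fr x [n [v [c [Fv [c1 xE]]]]].
under eq_bigr do rewrite xE; rewrite exchange_big /=.
under eq_bigr => i _ do rewrite -mulr_sumr (Fr _ (Fv i)).
by rewrite -mulr_suml c1 mul1r.
Qed.

(* Comparing the origin with the vertex on the u-axis forces both levels of a chain
   facet through u, and hence its right-hand side. *)
Lemma two_level_spikes {z} : core (mcp le M lam) z -> two_level (mcp le M lam) ->
  forall a s b (u : U), marked_chain le M a s b -> val u \in s ->
    is_facet (mcp le M lam) (chain_face le M lam a s b) ->
    mcp le M lam (spike u (lam b - lam a)).
Proof.
move=> cz tl a s b u mc us fc.
have [a' aL] := lower_mark_exists _ _ _ (val u) mp.
have [b' bU] := upper_mark_exists _ _ _ (val u) mp.
have h0 := marks_spread_gt0 mp u _ _ cz aL bU.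
have Qs := spike_mcp u _ _ (ltW h0) aL bU.
have rhs : lam b' - lam a' <= lam b - lam a.
  by have [_ /(_ _ _ _ mc)] := Qs; rewrite sum_spike us mul1r.
have [t tP] := tl _ fc.
pose S (x : pt R U) := \sum_(u | val u \in s) x u.
have lev x : is_vertex (mcp le M lam) x -> S x = lam b - lam a \/ S x - S t = lam b - lam a.
  have hull := aff_hull_sum (chain_face le M lam a s b) (fun u => val u \in s) (lam b - lam a).
  move=> /tP[/hull Sx|/hull Sx]; [left|right].
    by apply: Sx => y [].
  rewrite -[RHS]Sx => [|y [] //]; rewrite /S -sumrB.
  by apply: eq_bigr => v _; rewrite ffunE.
have S0 : S [ffun=> 0] = 0 by rewrite /S big1 // => v _; rewrite ffunE.
have Su : S (spike u (lam b' - lam a')) = lam b' - lam a'.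
  by rewrite /S sum_spike us mul1r.
(* Let [h] be the spread at [u] and [r] the right-hand side, so [0 < h <= r]. The origin is not on
   the facet, hence [- S t = r]; were the spike off the facet, then [h + r = r]. *)
have := lev _ origin_vertex; have := lev _ (spike_vertex u _ _ (ltW h0) aL bU).
rewrite S0 Su => hu h00; suff -> : lam b - lam a = lam b' - lam a' by [].
by case: hu; case: h00; lra.
Qed.
End TwoLevelSpikes.

(** * Marked chain polytopes whose chain facets have right-hand side 1 *)

Section UnitFacets.
Context {R : realType} {T : finType} {le : rel T} {M : {set T}} {lam : T -> R}.
Hypothesis mp : marked_poset le M lam.

(** A unit vector has every chain sum at most 1, so it satisfies all facet inequalities and lies in
    the polytope. *)
Lemma unit_facets_spikes {z} : core (mcp le M lam) z ->
  (forall a s b, marked_chain le M a s b ->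
    is_facet (mcp le M lam) (chain_face le M lam a s b) -> lam b - lam a = 1) ->
  forall a s b (u : {p : T | p \notin M}), marked_chain le M a s b -> val u \in s ->
    is_facet (mcp le M lam) (chain_face le M lam a s b) ->
    mcp le M lam (spike u (lam b - lam a)).
Proof.
move=> cz unit a s b u mc us fc; rewrite (unit _ _ _ mc fc).
apply: (mcp_of_facets mp cz) => [v|a' s' b' v mc' _ /(unit _ _ _ mc')->].
  by rewrite ffunE mulr_ge0 ?ler0n.
by rewrite sum_spike mulr1; case: (val u \in s').
Qed.
End UnitFacets.

(** * Chain polytopes as marked chain polytopes *)

Section Bounding.
Context {R : realType} {Q : finType} (le : rel Q).
Hypothesis poset : is_poset le.

(* [inr false] and [inr true] are a new bottom and a new top. *)
Definition bounded_le : rel (Q + bool) := fun x y =>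
  match x, y with
  | inl p, inl q => le p q
  | inr c, inr d => c ==> d
  | inl _, inr d => d
  | inr c, inl _ => ~~ c
  end.

Definition bounded_marks : {set Q + bool} := [set x | if x is inr _ then true else false].

Definition bounded_lam (x : Q + bool) : R := if x is inr true then 1 else 0.

Lemma bounded_marked_poset : marked_poset bounded_le bounded_marks bounded_lam.
Proof.
case: poset => lexx [leA leT]; split.
- split; first by case=> [p|[]] /=.
  split; first by case=> [p|[]] [q|[]] //= /leA->.
  by case=> [p|[]] [q|[]] [r|[]] //=; exact: leT.
- by case=> [p|[]] h; rewrite inE //; have := h (inr false) isT.
- by case=> [p|[]] h; rewrite inE //; have := h (inr true) isT.
by case=> [p|[]] [q|[]]; rewrite !inE //= ler01.
Qed.

Let mp := bounded_marked_poset.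

Lemma bounded_chain_rhs a s b : marked_chain bounded_le bounded_marks a s b ->
  bounded_lam b - bounded_lam a = 1.
Proof.
move=> mc; case: (mc) => aM bM _ _ _; case: mp => po _ _ _.
have := marked_chain_ltp _ po _ _ _ _ mc; move: aM bM; rewrite !inE.
by case: a {mc} => [//|[]]; case: b => [//|[]] //; rewrite /= subr0.
Qed.

Lemma unmarked_inl (p : Q) : inl p \notin bounded_marks.
Proof. by rewrite inE. Qed.

Definition unmarked (p : Q) : {x | x \notin bounded_marks} :=
  exist _ (inl p) (unmarked_inl p).

Lemma unmarked_bij : bijective unmarked.
Proof.
have g (w : {x | x \notin bounded_marks}) : {p | unmarked p = w}.
  by case: w => -[p|c] wM; [exists p; exact: val_inj | exfalso; move: wM; rewrite inE].
exists (fun w => sval (g w)) => [p|w]; last exact: (svalP (g w)).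
by have /(congr1 val)[] := svalP (g (unmarked p)).
Qed.

(** A chain of [le] is never separated by the new bottom or top, so it extends to a saturated marked
    chain; conversely the unmarked part of a marked chain is a chain of [le]. *)
Lemma bounded_mcpE (y : pt R {x | x \notin bounded_marks}) :
  mcp bounded_le bounded_marks bounded_lam y <->
  chain_polytope le [ffun p => y (unmarked p)].
Proof.
have [g gK Kg] := unmarked_bij; case: (mp) => po _ _ _.
have reidx (P : pred {x | x \notin bounded_marks}) :
    \sum_(w | P w) y w = \sum_(p | P (unmarked p)) y (unmarked p).
  by apply: reindex; exists g => p _.
split=> -[y0 yC]; split=> [c|].
- by rewrite ffunE.
- move=> C Cc; have [->|[c cC]] := set_0Vmem C; first by rewrite big_set0.
  have [||||a [s [b [mc Cs _ _]]]] := chain_extension mp (C := inl @: C).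
  + by apply/set0Pn; exists (inl c); rewrite imset_f.
  + by move=> _ _ /imsetP[p pC ->] /imsetP[q qC ->]; exact: Cc.
  + by move=> _ /imsetP[p pC ->]; exact: unmarked_inl.
  + move=> _ _ m /imsetP[p pC ->] /imsetP[q qC ->]; rewrite inE.
    by case: m => [//|[]].
  rewrite -(bounded_chain_rhs _ _ _ mc); apply: le_trans (yC _ _ _ mc).
  under eq_bigr do rewrite ffunE.
  rewrite reidx /= [leRHS](bigID [in C]) /= ler_wpDr ?sumr_ge0 //.
  apply/eq_ler/eq_bigl => p.
  by case pC: (p \in C); rewrite ?andbF // Cs ?imset_f.
- by rewrite -(Kg c); have := y0 (g c); rewrite ffunE.
move=> a s b mc; rewrite (bounded_chain_rhs _ _ _ mc) reidx /=.
have Cc : is_chain le [set p | inl p \in s].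
  move=> p q; rewrite !inE => ps qs.
  exact: (marked_chain_is_chain _ po _ _ _ _ _ _ mc ps qs).
rewrite (eq_bigl [in [set p | inl p \in s]]) => [|p]; last by rewrite inE.
apply: le_trans (yC _ Cc); apply/eq_ler/eq_bigr => p _.
by rewrite ffunE.
Qed.
End Bounding.

(** * The equivalences, all obtained through (c) *)

Theorem theorem4p4 (R : realType) (T : finType) (le : rel T) (M : {set T})
    (lam : T -> R) :
  marked_poset le M lam -> strict_marking le M lam -> irredundant le M lam ->
  let a_ := two_level (mcp le M lam) in
  let b_ :=
    exists (T' : finType) (le' : rel T') (M' : {set T'}) (lam' : T' -> R),
      [/\ marked_poset le' M' lam',
          aff_isomorphic (mcp le M lam) (mcp le' M' lam') &
          forall a s b, marked_chain le' M' a s b ->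
            is_facet (mcp le' M' lam')
              (fun x => mcp le' M' lam' x /\
                 \sum_(u | val u \in s) x u = lam' b - lam' a) ->
            lam' b - lam' a = 1] in
  let c_ :=
    exists (Q : finType) (leQ : rel Q),
      is_poset leQ /\ aff_isomorphic (mcp le M lam) (chain_polytope leQ) in
  (a_ <-> b_) /\ (b_ <-> c_).
Proof.
move=> mp st _ a_ b_ c_; have [z cz] := strict_mcp_core mp st.
have ac : a_ -> c_.
  by move=> tl; apply: (mcp_iso_chain_polytope mp cz); exact: two_level_spikes cz tl.
have ca : c_ -> a_.
  by move=> [Q [leQ [poQ iso]]]; exact: two_level_iso_chain_polytope cz iso.
have cb : c_ -> b_.
  move=> [Q [leQ [poQ iso]]].
  exists _, (bounded_le leQ), bounded_marks, bounded_lam; split.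
  - exact: bounded_marked_poset.
  - have [g gK Kg] := @unmarked_bij Q.
    apply: (aff_isomorphic_reindex g) iso; first by exists unmarked.
    move=> y; rewrite bounded_mcpE //; have -> // : [ffun p => [ffun w => y (g w)] (unmarked p)] = y.
    by apply/ffunP => p; rewrite !ffunE gK.
  by move=> a s b mc _; exact: bounded_chain_rhs mc.
have bc : b_ -> c_.
  move=> [T' [le' [M' [lam' [mp' iso unit]]]]].
  have [A [c [f_bij QE]]] := iso.
  (* [lam'] is not assumed strict; the interior point of the second polytope is the image of [z]. *)
  have cz' := core_affmap _ _ _ _ f_bij QE _ cz.
  have [Q [leQ [poQ iso']]] :=
    mcp_iso_chain_polytope mp' cz' (unit_facets_spikes mp' cz' unit).
  by exists Q, leQ; split=> //; exact: aff_isomorphic_trans iso iso'.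
by split; [split=> [/ac/cb|/bc/ca] | split=> [/bc|/cb]].
Qed.
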